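(* Let $X$ be a metric space with integer valued metric. Suppose that for every $f\in\mathrm{E}(X)$ there exist $\varepsilon,N>0$ such that $\mathrm{rk}(A(g))\le N$ for all $g\in\mathrm{E}'(X)$ with $\|f-g\|_\infty<\varepsilon$. Then: (1) $\mathrm{E}'(X)=\mathrm{E}(X)$; (2) $\mathscr P=\{P(A)\}_{A\in\mathscr A(X)}$ is a polyhedral structure on $\mathrm{E}(X)$ with locally finite dimension, in which $P(A')$ is a face of $P(A)$ if and only if $A\subset A'$; (3) for every $n\ge1$ and $D>0$, $\mathscr P$ has only finitely many isometry types of $n$-cells with diameter at most $D$; if in addition $X$ is discretely path-connected, then for every $n$ there are only finitely many isometry types of $n$-cells.
   Context: $\Delta(X)=\{f\in\mathbb R^X: f(x)+f(y)\ge d(x,y)\ \forall x,y\}$, ordered pointwise; $\mathrm{E}(X)$ is its set of minimal elements, with metric $\|f-g\|_\infty$. $A(f)$ is the set of unordered pairs $\{x,y\}$ ($x=y$ allowed) with $f(x)+f(y)=d(x,y)$; $\mathrm{E}'(X)=\{f\in\Delta(X):\bigcup A(f)=X\}$; $\mathscr A(X)=\{A(f):f\in\mathrm E'(X)\}$; $H(A)=\{g\in\mathbb R^X: g(x)+g(y)=d(x,y)\ \forall\{x,y\}\in A\}$, $\mathrm{rk}(A)=\dim H(A)$, $P(A)=\mathrm E'(X)\cap H(A)$. A polyhedral structure on a set is a family of polytopes (cells, each in a finite-dimensional affine subspace, metrized by the sup norm) covering it, such that faces of cells are cells and the intersection of two cells is empty or a common face. $X$ is discretely path-connected if any $x,y\in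 X$ are joined by a sequence $x=\gamma(0),\dots,\gamma(l)=y$ with $d(\gamma(k-1),\gamma(k))=1$. *)

(* Defs.v *)
From HB Require Import structures.
From mathcomp Require Import all_boot all_order all_algebra.
From mathcomp Require Import Rstruct.
Set Implicit Arguments. Unset Strict Implicit. Unset Printing Implicit Defensive.
Import Order.TTheory GRing.Theory Num.Theory.
Local Open Scope ring_scope.

Notation R := Rdefinitions.R.

Section Defs.
Variable X : Type.

Definition int_metric (d : X -> X -> nat) : Prop :=
  (forall x y, d x y = 0%N <-> x = y) /\
  (forall x y, d x y = d y x) /\
  (forall x y z, (d x z <= d x y + d y z)%N).

Definition discretely_path_connected (d : X -> X -> nat) : Prop :=
  forall x y : X, exists (l : nat) (gam : nat -> X),
    gam 0%N = x /\ gam l = y /\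
    forall k : nat, (1 <= k <= l)%N -> d (gam k.-1) (gam k) = 1%N.

Variable d : X -> X -> nat.

Definition Delta (f : X -> R) : Prop :=
  forall x y : X, (d x y)%:R <= f x + f y.

Definition Ehull (f : X -> R) : Prop :=
  Delta f /\ forall g : X -> R, Delta g -> (forall x, g x <= f x) -> forall x, g x = f x.

(* A(f), as a (symmetric) relation: {x,y} in A(f) iff f x + f y = d x y *)
Definition Aset (f : X -> R) : X -> X -> Prop :=
  fun x y => f x + f y = (d x y)%:R.

Definition Eprime (f : X -> R) : Prop :=
  Delta f /\ forall x : X, exists y : X, Aset f x y.

Definition Hspace (A : X -> X -> Prop) (g : X -> R) : Prop :=
  forall x y, A x y -> g x + g y = (d x y)%:R.

Definition Pcell (A : X -> X -> Prop) (g : X -> R) : Prop :=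
  Eprime g /\ Hspace A g.

Definition in_scrA (A : X -> X -> Prop) : Prop :=
  exists f, Eprime f /\ forall x y, A x y <-> Aset f x y.

End Defs.

Section Geometry.
Variable X : Type.
Local Notation Fn := (X -> R).
Local Notation FSet := (Fn -> Prop).

Definition supdist_le (f g : Fn) (c : R) : Prop := forall x, `|f x - g x| <= c.
Definition supdist_lt (f g : Fn) (eps : R) : Prop :=
  exists c, c < eps /\ supdist_le f g c.

Definition aff_indep (k : nat) (p : 'I_k.+1 -> Fn) : Prop :=
  forall c : 'I_k.+1 -> R, \sum_i c i = 0 ->
    (forall x, \sum_i c i * p i x = 0) -> forall i, c i = 0.

Definition adim_le (S : FSet) (n : nat) : Prop :=
  forall p : 'I_n.+2 -> Fn, (forall i, S (p i)) -> ~ aff_indep p.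
Definition adim_eq (S : FSet) (n : nat) : Prop :=
  (exists p : 'I_n.+1 -> Fn, (forall i, S (p i)) /\ aff_indep p) /\ adim_le S n.

Definition polytope (C : FSet) : Prop :=
  exists (k : nat) (p : 'I_k.+1 -> Fn), forall g, C g <->
    exists c : 'I_k.+1 -> R, (forall i, 0 <= c i) /\ \sum_i c i = 1 /\
      forall x, g x = \sum_i c i * p i x.

Definition convex (S : FSet) : Prop :=
  forall p q (t : R), S p -> S q -> 0 <= t <= 1 ->
    S (fun x => (1 - t) * p x + t * q x).

Definition face (F C : FSet) : Prop :=
  (exists f, F f) /\ (forall f, F f -> C f) /\ convex F /\
  forall p q (t : R), C p -> C q -> 0 < t < 1 ->
    F (fun x => (1 - t) * p x + t * q x) -> F p /\ F q.

Definition polyhedral_structure (cells : FSet -> Prop) (S : FSet) : Prop :=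
  (forall C, cells C -> polytope C) /\
  (forall f, S f <-> exists C, cells C /\ C f) /\
  (forall C F, cells C -> face F C -> cells F) /\
  (forall C1 C2, cells C1 -> cells C2 ->
     (forall f, ~ (C1 f /\ C2 f)) \/
     (face (fun f => C1 f /\ C2 f) C1 /\ face (fun f => C1 f /\ C2 f) C2)).

Definition locally_finite_dim (cells : FSet -> Prop) (S : FSet) : Prop :=
  forall f, S f -> exists eps : R, 0 < eps /\ exists N : nat,
    forall C, cells C -> (exists g, C g /\ supdist_lt f g eps) -> adim_le C N.

Definition isometric (C1 C2 : FSet) : Prop :=
  exists phi : Fn -> Fn,
    (forall f, C1 f -> C2 (phi f)) /\
    (forall g, C2 g -> exists f, C1 f /\ phi f = g) /\
    (forall f g c, C1 f -> C1 g -> (supdist_le f g c <-> supdist_le (phi f) (phi g) c)).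

Definition diam_le (C : FSet) (D : R) : Prop :=
  forall f g, C f -> C g -> supdist_le f g D.

Definition finitely_many_isometry_types (Q : FSet -> Prop) : Prop :=
  exists (m : nat) (reps : 'I_m -> FSet), forall C, Q C -> exists i : 'I_m, isometric C (reps i).

End Geometry.

Definition Pfamily (X : Type) (d : X -> X -> nat) (C : (X -> R) -> Prop) : Prop :=
  exists A, in_scrA d A /\ forall g, C g <-> Pcell d A g.

(* Main.v *)
(** For [f] in E(X), let [res (f x)] be the signed distance from [f x] to the nearest integer.
    If [f] has a tight pair {x, y}, then [res (f y) = - res (f x)] (or both are -1/2), so
    distinct values of [|res (f x)|] strictly between 0 and 1/2 give linearly independent
    directions of H(A(f)).  Hence the local rank condition bounds the number of these values
    for [f] in E'(X); as E'(X) is dense in E(X) the bound passes to E(X), so that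
    [f x + f y - d x y] takes discrete values and the infimum over [y], which is 0, is attained:
    E'(X) = E(X).

    Composing the residues of [f] with an odd monotone function fixing 1/2 preserves
    both the inequalities defining Delta(X) and the tight pairs.  With step functions this
    makes [f] a convex combination of half-integral elements of P(A(f)).  Elements of a cell
    are determined by their values at [n = dim] points, so a cell of diameter at most [D] is
    the convex hull of at most [(4D + O(1))^n] half-integral points, and its isometry type
    only depends on the finite set of vectors of differences of these points, evaluated at
    the elements of X.  On a discretely path-connected space, the diameter is at most
    [2(n + 1)], because the difference of two elements of an [n]-cell has few levels and
    varies by at most 2 along an edge of a path. *)

Require Import Defs.
From HB Require Import structures.
From mathcomp Require Import all_boot all_order all_algebra.
From mathcomp Require Import Rstruct.
From mathcomp Require Import boolp classical_sets.
From mathcomp Require Import ring lra zify.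
Set Implicit Arguments. Unset Strict Implicit. Unset Printing Implicit Defensive.
Import Order.TTheory GRing.Theory Num.Theory.
Local Open Scope ring_scope.

(** * Residues: signed distance to the nearest integer *)

Definition res (t : R) : R := t - (Num.floor (t + 2^-1))%:~R.

Lemma res_itv t : - 2^-1 <= res t < 2^-1.
Proof.
rewrite /res; have := floor_le (t + 2^-1).
have := floorD1_gt (t + 2^-1); rewrite intrD; lra.
Qed.

Lemma norm_res_le t : `|res t| <= 2^-1.
Proof. by have := res_itv t; rewrite ler_norml; lra. Qed.

Lemma norm_res_min t (k : int) : `|res t| <= `|t - k%:~R|.
Proof.
have := res_itv t; rewrite /res; set j := Num.floor _ => h.
have [ejk|njk] := eqVneq j k; first by rewrite ejk.
have : 1 <= `|(j - k)%:~R : R|.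
  by rewrite -intr_norm ler1z -gtz0_ge1 normr_gt0 subr_eq0.
rewrite rmorphB /=.
have e : t - k%:~R = (t - j%:~R) + (j%:~R - k%:~R) :> R by ring.
rewrite e; move: (t - _) (j%:~R - _) h => u v h.
rewrite ler_norml; case: (ger0P (u + v)); case: (ger0P v); lra.
Qed.

Lemma norm_res_lip s t : `|res s| <= `|res t| + `|s - t|.
Proof.
apply: le_trans (norm_res_min s (Num.floor (t + 2^-1))) _.
suff -> : s - (Num.floor (t + 2^-1))%:~R = res t + (s - t) by apply: ler_normD.
by rewrite /res; ring.
Qed.

(** * Odd monotone maps acting on residues *)

Section OddMonotone.
Variable phi : R -> R.
Hypotheses (phiN : forall t, phi (- t) = - phi t)
  (phi_mono : {homo phi : s t / s <= t}) (phi_half : phi 2^-1 = 2^-1).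

(** If [k >= 1], both [phi] values are at least -1/2; if [k = 0], apply [phi] to [- r' <= r]; if
    [k < 0], necessarily [r = r' = 1/2], which [phi] fixes. *)
Lemma odd_mono_ge0 (k : int) (r r' : R) : `|r| <= 2^-1 -> `|r'| <= 2^-1 ->
  0 <= k%:~R + r + r' -> 0 <= k%:~R + phi r + phi r'.
Proof.
rewrite !ler_norml => /andP[h1 h2] /andP[h3 h4] h.
have a1 := phi_mono h1; have a3 := phi_mono h3.
rewrite phiN phi_half in a1 a3.
have [k1|k1|k0] := ltrgtP k 0.
- have : k%:~R <= -1 :> R by rewrite -[-1]/(- (1%:~R)) -mulrNz ler_int; lia.
  move=> k2; have er : r = 2^-1 by lra.
  have er' : r' = 2^-1 by lra.
  by rewrite er er' phi_half; lra.
- have : 1%:~R <= k%:~R :> R by rewrite ler_int; lia.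
  by lra.
- rewrite k0 mulr0z add0r in h *; have /phi_mono : - r' <= r by lra.
  by rewrite phiN; lra.
Qed.

Lemma odd_mono_eq0 (k : int) (r r' : R) : `|r| <= 2^-1 -> `|r'| <= 2^-1 ->
  k%:~R + r + r' = 0 -> k%:~R + phi r + phi r' = 0.
Proof.
move=> hr hr' e; have := @odd_mono_ge0 k r r' hr hr'; rewrite e lexx => /(_ isT).
have := @odd_mono_ge0 (- k) (- r) (- r'); rewrite !normrN !phiN mulrNz => /(_ hr hr').
lra.
Qed.
End OddMonotone.

(** Used with [c = 0], a threshold, and with [c = 1/(2b)], which stretches the level [b] to 1/2. *)
Definition oddstep (b c t : R) : R :=
  if t < - b then - 2^-1 else if b < t then 2^-1 else c * t.

Lemma oddstepN b c t : 0 <= b -> oddstep b c (- t) = - oddstep b c t.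
Proof.
rewrite /oddstep => b0; rewrite ltrN2 (ltrNr b t).
by case: (ltP b t) => h1; case: (ltP t (- b)) => h2; lra.
Qed.

Lemma oddstep_homo b c : 0 <= b -> 0 <= c -> c * b <= 2^-1 ->
  {homo oddstep b c : s t / s <= t}.
Proof.
move=> b0 c0 cb s t st; rewrite /oddstep.
have bound u : - b <= u -> u <= b -> - 2^-1 <= c * u <= 2^-1.
  by move=> h1 h2; apply/andP; split; nra.
case: (ltP s (- b)) => h1; case: (ltP t (- b)) => h2 //;
 case: (ltP b s) => h3; case: (ltP b t) => h4 //; try lra.
- by have := bound t; lra.
- by have := bound s; lra.
- by rewrite ler_wpM2l.
Qed.

Lemma oddstep_half b c : 0 <= b < 2^-1 -> oddstep b c 2^-1 = 2^-1.
Proof. by move=> h; rewrite /oddstep; case: ltP => h1; [lra|]; case: ltP => h2 //; lra. Qed.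

Lemma oddstep_in b c t : `|t| <= b -> oddstep b c t = c * t.
Proof. by rewrite ler_norml /oddstep => h; case: ltP => h1; [lra|case: ltP => h2 //; lra]. Qed.

(** * Half-integral decomposition by thresholding *)

Section Cells.
Variables (X : Type) (d : X -> X -> nat).
Implicit Types (f g h v : X -> R) (A : X -> X -> Prop).

Definition half_integral f := forall x, exists k : int, f x = k%:~R / 2.

Definition finite_residues f := exists s : seq R, forall x, `|res (f x)| \in s.

Lemma Pcell_of f g : Eprime d f -> Delta d g ->
  (forall x y, Aset d f x y -> Aset d g x y) -> Pcell d (Aset d f) g.
Proof.
move=> [_ fE] gD fg; split; last by move=> x y /fg.
by split=> // x; have [y /fg] := fE x; exists y.
Qed.

Lemma Delta_mix p q (t : R) : Delta d p -> Delta d q -> 0 <= t <= 1 ->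
  Delta d (fun x => (1 - t) * p x + t * q x).
Proof. by move=> pD qD t01 x y; have := pD x y; have := qD x y; nra. Qed.

Lemma Aset_mix p q (t : R) x y : Aset d p x y -> Aset d q x y ->
  Aset d (fun x => (1 - t) * p x + t * q x) x y.
Proof.
rewrite /Aset => px qx; transitivity ((1 - t) * (p x + p y) + t * (q x + q y)); first ring.
by rewrite px qx; ring.
Qed.

Lemma Aset_mix_inv p q (t : R) x y : Delta d p -> Delta d q -> 0 < t < 1 ->
  Aset d (fun x => (1 - t) * p x + t * q x) x y -> Aset d p x y /\ Aset d q x y.
Proof.
move=> /(_ x y) pD /(_ x y) qD t01; rewrite /Aset => e.
by split; nra.
Qed.

(* Thresholding the residues of [f] by odd monotone step functions writes [f] as a
   convex combination of half-integral functions with no fewer tight pairs. *)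
Lemma hull_residues (A : X -> X -> Prop) (S : (X -> R) -> Prop) :
  convex S ->
  (forall h, half_integral h -> Delta d h -> Hspace d A h -> S h) ->
  forall (s : seq R), sorted >%R s -> {in s, forall a, 0 < a < 2^-1} ->
  forall (m : X -> int) (r : X -> R),
  (forall x, `|r x| \in [:: 0, 2^-1 & s]) ->
  Delta d (fun x => (m x)%:~R + r x) -> Hspace d A (fun x => (m x)%:~R + r x) ->
  S (fun x => (m x)%:~R + r x).
Proof.
move=> Sconv Shalf s; have [n] := ubnP (size s).
(* The list is decreasing, so [b] is the largest level strictly between 0 and 1/2. Both step maps
   below remove it. *)
elim: n s => // n IH [|b s] /= sn sS sI m r rI gD gA.
  apply: Shalf => // x; have := rI x; rewrite !inE normr_eq0.
  case/orP => [/eqP -> |]; first by exists (2 * m x); rewrite rmorphM /=; field.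
  rewrite eqr_norml => /andP[/orP[] /eqP -> _].
    by exists (2 * m x + 1); rewrite rmorphD rmorphM /=; field.
  by exists (2 * m x - 1); rewrite rmorphB rmorphM /=; field.
have /sI bI : b \in b :: s by rewrite inE eqxx.
have sb a : a \in s -> a < b by move/(allP (order_path_min (rev_trans lt_trans) sS)).
have rhalf x : `|r x| <= 2^-1.
  have := rI x; rewrite !inE => /or4P[/eqP->|/eqP->|/eqP->|/sb]; lra.
pose c := (2 * b)^-1.
have cb : c * b = 2^-1 by rewrite /c; field; lra.
have c0 : 0 <= c by rewrite /c invr_ge0; lra.
have push e : 0 <= e -> e * b <= 2^-1 ->
    Delta d (fun x => (m x)%:~R + oddstep b e (r x)) /\
    Hspace d A (fun x => (m x)%:~R + oddstep b e (r x)).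
  move=> e0 eb.
  have eN t := @oddstepN b e t (ltW (proj1 (andP bI))).
  have emono := @oddstep_homo b e (ltW (proj1 (andP bI))) e0 eb.
  have ehalf : oddstep b e 2^-1 = 2^-1 by apply: oddstep_half; lra.
  have E x y (u v : R) : (m x)%:~R + u + ((m y)%:~R + v) =
      (m x + m y - (d x y)%:Z)%:~R + u + v + (d x y)%:R.
    by rewrite rmorphB rmorphD /= -!pmulrn; ring.
  split=> x y.
    have := gD x y; rewrite !E -subr_ge0 addrK => /(odd_mono_ge0 eN emono ehalf).
    by move=> /(_ (rhalf _) (rhalf _)); lra.
  move=> /gA; rewrite !E => e1.
  have /(odd_mono_eq0 eN emono ehalf) : (m x + m y - (d x y)%:Z)%:~R + r x + r y = 0 by lra.
  by move=> /(_ (rhalf _) (rhalf _)); lra.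
have [g0D g0A] := push 0 (lexx _) ltac:(lra).
have [g1D g1A] := push c c0 ltac:(lra).
have {push} S0 : S (fun x => (m x)%:~R + oddstep b 0 (r x)).
  apply: (IH [::]) => //= [|x]; first by lia.
  rewrite !inE.
  rewrite /oddstep mul0r.
  case: ltP => h1; first by rewrite normrN ger0_norm ?eqxx ?orbT //; lra.
  case: ltP => h2; first by rewrite ger0_norm ?eqxx ?orbT //; lra.
  by rewrite normr0 eqxx.
have {IH} S1 : S (fun x => (m x)%:~R + oddstep b c (r x)).
  apply: (IH [seq c * a | a <- s]) => //.
  - by rewrite size_map.
  - apply: homo_sorted (path_sorted sS) => u v /=.
    by rewrite ltr_pM2l // /c invr_gt0; lra.
  - move=> _ /mapP[a sa ->]; have := sb _ sa.
    have /sI := (mem_behead (s := b :: s) sa).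
    have : 0 < c by rewrite /c invr_gt0; lra.
    by nra.
  move=> x; have := rI x; rewrite !inE.
  have small t : `|t| <= b -> `|oddstep b c t| = c * `|t|.
    by move=> tb; rewrite oddstep_in // normrM ger0_norm.
  case/or4P => [/eqP e|/eqP e|/eqP e|e].
  - by rewrite small e ?mulr0 ?eqxx //; lra.
  - have : oddstep b c `|r x| = 2^-1 by rewrite e oddstep_half //; lra.
    move=> e2; suff -> : `|oddstep b c (r x)| = 2^-1 by rewrite eqxx orbT.
    move: e2; case: (ger0P (r x)) => _; rewrite ?oddstepN; try lra; move=> e2.
      by rewrite e2 ger0_norm; lra.
    by rewrite -normrN e2 ger0_norm; lra.
  - by rewrite small e ?cb ?eqxx ?orbT //; lra.
  - by rewrite small ?ltW ?sb // map_f ?orbT.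
(* Where [|r x| <= b] the two step maps give 0 and [r x / (2b)]; where [|r x| = 1/2] both give
   [r x]. Hence the weights [1 - 2b] and [2b] recover [r]. *)
have := Sconv _ _ (2 * b) S0 S1 ltac:(lra).
congr S; apply/funext => x.
suff : r x = (1 - 2 * b) * oddstep b 0 (r x) + 2 * b * oddstep b c (r x).
  by move=> e; rewrite [in RHS]e; ring.
have : `|r x| <= b \/ `|r x| = 2^-1.
  have := rI x; rewrite !inE.
  by case/or4P => [/eqP->|/eqP->|/eqP->|/sb/ltW]; [left; lra|right|left|left].
case=> [rb|rb].
  by rewrite !oddstep_in // /c; field; lra.
move: rb; rewrite /oddstep; case: ger0P => ? e; case: ltP => h1; try lra;
  case: ltP => h2; lra.
Qed.
End Cells.

(** * Hull principle, slack gaps and interior directions *)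

Section Hull.
Variables (X : Type) (d : X -> X -> nat).
Hypothesis hd : int_metric d.
Implicit Types (f g h v : X -> R) (A : X -> X -> Prop).

(** Quantifying over convex sets [S] says that [f] is in the convex hull of the half-integral points
    of its cell, without naming coefficients. *)
Lemma hull f (S : (X -> R) -> Prop) : Eprime d f -> finite_residues f -> convex S ->
  (forall h, half_integral h -> Pcell d (Aset d f) h -> S h) -> S f.
Proof.
move=> fE [s0 fs0] Sconv Shalf.
pose s := rev (sort <=%R (undup [seq a <- s0 | 0 < a < 2^-1])).
have memP a : (a \in s) = (0 < a < 2^-1) && (a \in s0).
  by rewrite mem_rev mem_sort mem_undup mem_filter.
have fe : (fun x => (Num.floor (f x + 2^-1))%:~R + res (f x)) = f.
  by apply/funext => x; rewrite /res; ring.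
rewrite -fe; apply: (@hull_residues _ _ (Aset d f) _ Sconv _ s).
- by move=> h hh hD hA; apply: Shalf => //; apply: Pcell_of.
- by rewrite rev_sorted sort_lt_sorted undup_uniq.
- by move=> a; rewrite memP => /andP[].
- move=> x; rewrite !inE memP fs0 andbT.
  have := norm_res_le (f x); have := normr_ge0 (res (f x)).
  rewrite le_eqVlt eq_sym => /orP[-> //|->].
  by rewrite le_eqVlt => /orP[->|->]; rewrite ?orbT.
- by rewrite fe; case: fE.
- by rewrite fe => x y.
Qed.

Lemma Eprime_Ehull f : Eprime d f -> Ehull d f.
Proof.
move=> [fD fE]; split=> // g gD gf x; apply/le_anti; rewrite gf /=.
by have [y] := fE x; rewrite /Aset; have := gD x y; have := gf y; lra.
Qed.

Lemma Delta_ge0 f x : Delta d f -> 0 <= f x.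
Proof. by move=> /(_ x x); have := ler0n R (d x x); lra. Qed.

(** Otherwise lowering [f x] by [e / 2] contradicts minimality; only half of [e], because the pair
    {x, x} loses twice the decrease. *)
Lemma Ehull_nearly_tight f x (e : R) : Ehull d f -> 0 < e ->
  exists y, f x + f y < (d x y)%:R + e.
Proof.
move=> [fD fmin] e0; apply: contrapT => /forallNP no.
have slack y : (d x y)%:R + e <= f x + f y by rewrite leNgt; apply/negP/no.
pose g z := if `[< z = x >] then f x - e / 2 else f z.
have gf z : g z <= f z by rewrite /g; case: asboolP => [->|//]; lra.
have gD : Delta d g.
  have [_ [dC _]] := hd.
  move=> y z; rewrite /g; case: asboolP => [->|_]; case: asboolP => [->|_] //.
  - by have := slack x; lra.
  - by have := slack z; lra.
  - by have := slack y; rewrite dC; lra.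
have := fmin g gD gf x; rewrite /g; case: asboolP => // _; lra.
Qed.

Lemma Eprime_lip f x z : Eprime d f -> f x <= (d x z)%:R + f z.
Proof.
move=> [fD fE]; have [y] := fE x; rewrite /Aset => e.
have [_ [dC tri]] := hd.
have : (d x y)%:R <= (d x z)%:R + (d z y)%:R :> R by rewrite -natrD ler_nat.
have := fD z y; lra.
Qed.

Lemma Eprime_dist f g x z : Eprime d f -> Eprime d g -> `|f x - g x| <= f z + g z.
Proof.
move=> fE gE; have := Eprime_lip x z fE; have := Eprime_lip x z gE.
have := fE.1 x z; have := gE.1 x z; rewrite ler_norml; lra.
Qed.

(** The least positive element of Z + t is [floor(-t) + 1 + t]; take the minimum over the list. *)
Lemma positive_gap (s : seq R) : exists2 e : R, 0 < e &
  forall t (k : int), t \in s -> 0 < k%:~R + t -> e <= k%:~R + t.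
Proof.
elim: s => [|t s [e e0 IH]]; first by exists 1.
pose e' := (Num.floor (- t) + 1)%:~R + t.
have e'0 : 0 < e' by have := floorD1_gt (- t); rewrite /e'; lra.
exists (Num.min e e'); first by rewrite lt_min e0.
move=> u k; rewrite inE => /orP[/eqP->|/IH h] k0.
  rewrite ge_min; apply/orP; right; rewrite lerD2r ler_int.
  by rewrite lezD1 -(ltr_int R); apply: le_lt_trans (floor_le _) _; lra.
by rewrite ge_min h.
Qed.

(** The slack of a pair is an integer plus a sum of two residues, so it lies in finitely many
    translates of Z. *)
Lemma finite_residues_gap f : finite_residues f -> exists2 e : R, 0 < e &
  forall x y, (d x y)%:R < f x + f y -> (d x y)%:R + e <= f x + f y.
Proof.
move=> [s fs]; pose s' := s ++ [seq - a | a <- s].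
have fs' x : res (f x) \in s'.
  rewrite mem_cat; have := fs x; case: ger0P => _; first by move->.
  by move=> h; rewrite -[res _]opprK map_f ?orbT.
have [e e0 he] := positive_gap [seq a + b | a <- s', b <- s'].
exists e => // x y xy.
have := he _ (Num.floor (f x + 2^-1) + Num.floor (f y + 2^-1) - (d x y)%:Z)
  (allpairs_f (fun a b => a + b) (fs' x) (fs' y)).
rewrite rmorphB rmorphD /= -pmulrn /res => h.
have : 0 < f x + f y - (d x y)%:R by lra.
move: h; set u := _ + _; have -> : u = f x + f y - (d x y)%:R by rewrite /u; ring.
by move=> h /h; lra.
Qed.

Lemma finite_residues_Eprime f : Ehull d f -> finite_residues f -> Eprime d f.
Proof.
move=> fE fr; split=> [|x]; first by case: fE.
have [e e0 he] := finite_residues_gap fr.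
have [y xy] := Ehull_nearly_tight x fE e0; exists y.
apply/le_anti; rewrite fE.1 andbT leNgt; apply/negP => /he; lra.
Qed.

(** Off the tight pairs the slack has a positive lower bound, so a bounded direction can be followed
    a little without leaving Delta(X). *)
Lemma interior f v (b : R) : Eprime d f -> finite_residues f ->
  (forall x, `|v x| <= b) -> (forall x y, Aset d f x y -> v x + v y = 0) ->
  exists2 a : R, 0 < a & Pcell d (Aset d f) (fun x => f x + a * v x).
Proof.
move=> fE /finite_residues_gap[e e0 he] vb vA.
have [[x0]|noX] := pselect (inhabited X); last first.
  by exists 1 => //; apply: Pcell_of => // x; case: noX.
have b0 : 0 <= b by apply: le_trans (vb x0).
have p0 : 0 < 2 * b + 1 by lra.
pose a := e / (2 * b + 1).
have a0 : 0 < a by rewrite divr_gt0.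
have ae : a * (2 * b) <= e by rewrite -[leRHS](divfK (lt0r_neq0 p0)) -/a; nra.
exists a => //; apply: Pcell_of => // x y; rewrite /Aset; last first.
  by move=> xy; rewrite -xy; have := vA x y xy; nra.
have := fE.1 x y; rewrite le_eqVlt => /orP[/eqP xy|/he].
  by have := vA x y (esym xy); nra.
by have := vb x; have := vb y; rewrite !ler_norml; nra.
Qed.
End Hull.

(** * Lower bounds for affine dimension *)

Section Dimension.
Variable X : Type.
Implicit Types (f g v w : X -> R) (S : (X -> R) -> Prop).

Lemma triangular_free n (v : 'I_n -> X -> R) (z : 'I_n -> X) (c : 'I_n -> R) :
  (forall i, v i (z i) != 0) -> (forall i j : 'I_n, (i < j)%N -> v j (z i) = 0) ->
  (forall x, \sum_i c i * v i x = 0) -> forall i, c i = 0.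
Proof.
move=> vz vtri cv i; have [k] := ubnP (i : nat); elim: k i => // k IH i ik.
have := cv (z i); rewrite (bigD1 i) //= big1 ?addr0 => [|j ji].
  by move/eqP; rewrite mulf_eq0 (negbTE (vz i)) orbF => /eqP.
have [lij|lji|eij] := ltngtP i j; first by rewrite vtri ?mulr0.
  by rewrite IH ?mul0r //; apply: leq_trans lji _.
by case/eqP: ji; apply: val_inj.
Qed.

Lemma triangular_adim S f n (v : 'I_n.+1 -> X -> R) (z : 'I_n.+1 -> X) :
  S f -> (forall i, exists2 a, a != 0 & S (fun x => f x + a * v i x)) ->
  (forall i, v i (z i) != 0) -> (forall i j : 'I_n.+1, (i < j)%N -> v j (z i) = 0) ->
  ~ adim_le S n.
Proof.
move=> Sf Sv vz vtri.
have /boolp.choice[a /all_and2[a0 Sa]] :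
    forall i, exists a, a != 0 /\ S (fun x => f x + a * v i x).
  by move=> i; have [a] := Sv i; exists a.
pose p (i : 'I_n.+2) := if unlift ord0 i is Some j then fun x => f x + a j * v j x else f.
move=> /(_ p); apply; first by move=> i; rewrite /p; case: unliftP.
move=> c csum cp.
have c1 j : c (lift ord0 j) = 0.
  have : c (lift ord0 j) * a j = 0.
    apply: (triangular_free (c := fun j => c (lift ord0 j) * a j) vz vtri) => x.
    have := cp x; rewrite big_ord_recl /p unlift_none.
    under eq_bigr => i _ do rewrite liftK mulrDr mulrA.
    rewrite big_split /= -mulr_suml addrA -mulrDl.
    by move: csum; rewrite big_ord_recl => ->; rewrite mul0r add0r.
  by move/eqP; rewrite mulf_eq0 (negbTE (a0 j)) orbF => /eqP.
move=> i; have [j ->|->] := unliftP ord0 i; first exact: c1.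
by have := csum; rewrite big_ord_recl big1 ?addr0.
Qed.

(** For each level, the indicator of [w = w (z i)] minus that of [w = - w (z i)] is an odd function
    of [w], hence takes opposite values on pairs of [A]. Distinct levels of [|w|] have disjoint
    supports. *)
Lemma levels_adim S f (A : X -> X -> Prop) n w (z : 'I_n.+1 -> X) :
  S f ->
  (forall v, (forall x, `|v x| <= 1) -> (forall x y, A x y -> v x + v y = 0) ->
    exists2 a, a != 0 & S (fun x => f x + a * v x)) ->
  (forall x y, A x y -> w x + w y = 0) ->
  injective (fun i => `|w (z i)|) -> (forall i, w (z i) != 0) -> ~ adim_le S n.
Proof.
move=> Sf Sv wA winj w0.
pose v i x : R := (w x == w (z i))%:R - (w x == - w (z i))%:R.
apply: (@triangular_adim _ f _ v z Sf) => [i|i|i j ij].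
- apply: Sv => [x|x y xy].
    by rewrite /v; do 2!case: eqP => _; rewrite ?subrr ?subr0 ?sub0r ?normrN ?normr0 ?normr1.
  rewrite /v; have -> : w y = - w x by have := wA x y xy; lra.
  by rewrite eqr_opp eqr_oppLR; ring.
- by rewrite /v eqxx -addr_eq0 -mulr2n mulrn_eq0 (negbTE (w0 i)) subr0 oner_eq0.
have nij : `|w (z i)| != `|w (z j)|.
  by apply: contraTN ij => /eqP/winj ->; rewrite ltnn.
have n1 : w (z i) == w (z j) = false by apply: contraNF nij => /eqP ->.
have n2 : w (z i) == - w (z j) = false by apply: contraNF nij => /eqP ->; rewrite normrN.
by rewrite /v n1 n2 subrr.
Qed.

Lemma many_or_few (u : X -> R) (e : seq R) n :
  (exists z : 'I_n -> X, injective (fun i => u (z i)) /\ forall i, u (z i) \notin e) \/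
  exists s : seq R, forall x, u x \in e ++ s.
Proof.
elim: n => [|n [[z [zinj ze]]|]]; last by right.
  have z : 'I_0 -> X by case.
  by left; exists z; split; case.
pose s := [seq u (z i) | i : 'I_n].
have [us|/existsNP[x /negP]] := pselect (forall x, u x \in e ++ s); first by right; exists s.
rewrite mem_cat negb_or => /andP[xe xs]; left.
have xz i : u x <> u (z i).
  by move=> h; case/negP: xs; rewrite h; apply/mapP; exists i; rewrite ?mem_enum.
exists (fun i => if unlift ord_max i is Some j then z j else x).
split=> [i j|i]; last by case: unliftP.
case: unliftP => [i'|] ->; case: unliftP => [j'|] -> //= h.
- by rewrite (zinj _ _ h).
- by case: (xz i').
- by case: (xz j').
Qed.
End Dimension.

(** * Distinct residues force large rank *)

Section Residues.
Variables (X : Type) (d : X -> X -> nat).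

(** Residues lie in [-1/2, 1/2), so two residues -1/2 do not cancel; replacing this value by 0 makes
    the residues opposite in all cases. *)
Lemma res_opp s t (k : int) : s + t = k%:~R ->
  (if `|res s| == 2^-1 then 0 else res s) + (if `|res t| == 2^-1 then 0 else res t) = 0.
Proof.
move=> st.
pose j := k - Num.floor (s + 2^-1) - Num.floor (t + 2^-1).
have ej : res s + res t = j%:~R by rewrite /j !rmorphB /= -st /res; ring.
have := res_itv s; have := res_itv t => ht hs.
have : 0%:~R <= (j + 1)%:~R :> R by rewrite rmorphD /= -ej mulr1z mulr0z; lra.
have : j%:~R < 1%:~R :> R by rewrite -ej mulr1z; lra.
rewrite ltr_int ler_int => j1 j2.
have [j0|j0] : j = 0 \/ j = -1 by lia.
  have -> : res t = - res s by rewrite j0 mulr0z in ej; lra.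
  by rewrite normrN; case: eqP => _; lra.
rewrite j0 mulrNz in ej.
have -> : res t = - 2^-1 by lra.
have -> : res s = - 2^-1 by lra.
by rewrite normrN ger0_norm ?eqxx ?addr0 // invr_ge0.
Qed.

Lemma residues_adim (g : X -> R) n (z : 'I_n.+1 -> X) :
  injective (fun i => `|res (g (z i))|) ->
  (forall i, `|res (g (z i))| \notin [:: 0; 2^-1]) ->
  ~ adim_le (Hspace d (Aset d g)) n.
Proof.
move=> zinj z0.
have z0' i : `|res (g (z i))| == 2^-1 = false.
  by apply/negP => h; have := z0 i; rewrite !inE h orbT.
apply: (@levels_adim _ _ g (Aset d g) n
  (fun x => if `|res (g x)| == 2^-1 then 0 else res (g x)) z).
- by move=> x y.
- move=> v _ vA; exists 1; first by rewrite oner_neq0.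
  by move=> x y xy; have := vA x y xy; rewrite -xy; lra.
- by move=> x y xy; apply: (@res_opp _ _ (d x y)%:Z); rewrite -pmulrn -xy.
- by move=> i j; rewrite !z0'; apply: zinj.
- by move=> i; rewrite z0'; have := z0 i; rewrite !inE normr_eq0 negb_or => /andP[].
Qed.

End Residues.

(** * Density of E'(X) in E(X) *)

Section Density.
Variable X : Type.

Lemma ex_argmin_nat (T : Type) (A : T -> Prop) (m : T -> nat) t0 : A t0 ->
  exists2 t, A t & forall s, A s -> (m t <= m s)%N.
Proof.
have [n] := ubnP (m t0); elim: n t0 => // n IH t0 tn At0.
have [tmin|/existsNP[s /not_implyP[As /negP]]] := pselect (forall s, A s -> (m t0 <= m s)%N).
  by exists t0.
by rewrite -ltnNge => st; apply: (IH s) => //; apply: leq_trans st _.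
Qed.

(** Zorn's lemma: at each point some member of a chain attains the pointwise minimum. Of the members
    attaining it at [x] and at [y], the smaller one yields the inequality for this pair. *)
Lemma minimal_nat (e : X -> X -> nat) (h0 : X -> nat) :
  (forall x y, e x y <= h0 x + h0 y)%N -> exists h : X -> nat,
  [/\ forall x y, (e x y <= h x + h y)%N, forall x, (h x <= h0 x)%N &
   forall h' : X -> nat, (forall x y, e x y <= h' x + h' y)%N ->
     (forall x, h' x <= h x)%N -> forall x, (h x <= h' x)%N].
Proof.
move=> eh0.
pose P (h : X -> nat) := (forall x y, e x y <= h x + h y)%N /\ (forall x, h x <= h0 x)%N.
pose le (t s : {h | P h}) := `[< forall x, (sval s x <= sval t x)%N >].
have P0 : P h0 by split.
have [||A Atot|[h [h1 h2]] hmax] := ZL_preorder (exist P h0 P0) (R := le).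
- by move=> t; apply/asboolP.
- by move=> r s t /asboolP rs /asboolP st; apply/asboolP => x; apply: leq_trans (st x) (rs x).
- have [[t0 At0]|noA] := pselect (exists t, A t); last first.
    by exists (exist P h0 P0) => s As; case: noA; exists s.
  have /boolp.choice[t /all_and2[At tmin]] : forall x, exists t, A t /\
      forall s, A s -> (sval t x <= sval s x)%N.
    by move=> x; have [t] := ex_argmin_nat (fun t => sval t x) At0; exists t.
  have Pt : P (fun x => sval (t x) x).
    split=> [x y|x]; last by case: (svalP (t x)).
    have [/asboolP xy|/asboolP yx] := Atot _ _ (At x) (At y).
      by have [/(_ x y) h _] := svalP (t y); apply: leq_trans h _; rewrite leq_add2r.
    by have [/(_ x y) h _] := svalP (t x); apply: leq_trans h _; rewrite leq_add2l.
  by exists (exist P _ Pt) => s As; apply/asboolP => x; apply: tmin.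
exists h; split=> // h' h'1 h'2; apply/asboolP.
have Ph' : P h' by split=> // x; apply: leq_trans (h'2 x) _.
by apply: (hmax (exist P h' Ph')); apply/asboolP.
Qed.

Variable d : X -> X -> nat.
Hypothesis hd : int_metric d.

(** Round [M f] up to integers and take a minimal integral function [h] below. A positive slack of
    [h] is at least 1, so by minimality every point has a tight partner. A nearly tight partner for
    [f] bounds [h / M] from below. *)
Lemma Eprime_dense (f : X -> R) (M : nat) : Ehull d f -> (0 < M)%N ->
  exists2 g, Eprime d g & supdist_le f g M%:R^-1.
Proof.
move=> fE M0; have [dxx [dC _]] := hd.
have Mgt : 0 < M%:R :> R by rewrite ltr0n.
pose h0 x := (Num.truncn (M%:R * f x)).+1.
have f0 x : 0 <= M%:R * f x by rewrite mulr_ge0 ?(Delta_ge0 _ fE.1) ?ltW.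
have h0gt x : M%:R * f x < (h0 x)%:R by exact: truncnS_gt.
have h0le x : (h0 x)%:R <= M%:R * f x + 1.
  by rewrite /h0 -natr1 lerD2r truncn_le.
have h0D x y : (M * d x y <= h0 x + h0 y)%N.
  rewrite -(ler_nat R) natrM natrD.
  by have := fE.1 x y; have := h0gt x; have := h0gt y; nra.
have [h [hD hh0 hmin]] := minimal_nat h0D.
have MV (a b : R) : a / M%:R <= b = (a <= b * M%:R) by rewrite ler_pdivrMr.
pose g x : R := (h x)%:R / M%:R.
have gM x : g x * M%:R = (h x)%:R by rewrite /g divfK ?lt0r_neq0.
have gD : Delta d g.
  move=> x y; rewrite -(ler_pM2r Mgt) mulrDl !gM -natrM -natrD ler_nat mulnC; exact: hD.
have gf x : g x <= f x + M%:R^-1.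
  rewrite /g MV mulrDl mulVf ?lt0r_neq0 // mulrC; apply: le_trans (h0le x).
  by rewrite ler_nat.
exists g; last first.
  move=> x; rewrite ler_norml; apply/andP; split; first by have := gf x; lra.
  rewrite lerBlDr; apply/ler_addgt0Pr => e e0.
  have [y xy] := Ehull_nearly_tight hd x fE e0.
  by have := gD x y; have := gf y; lra.
split=> // x; apply: contrapT => /forallNP no.
have slack y : (M * d x y < h x + h y)%N.
  rewrite ltn_neqAle hD andbT; apply/eqP => e; apply: (no y); rewrite /Aset.
  apply: (mulIf (lt0r_neq0 Mgt)).
  by rewrite mulrDl !gM -natrM -natrD mulnC e.
pose h' z := if `[< z = x >] then (h x).-1 else h z.
have h'h z : (h' z <= h z)%N by rewrite /h'; case: asboolP => [->|//]; apply: leq_pred.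
have h'D y z : (M * d y z <= h' y + h' z)%N.
  rewrite /h'; case: asboolP => [->|_]; case: asboolP => [->|_] //.
  - by rewrite (proj2 (dxx x x)) // muln0.
  - by have := slack z; lia.
  - by rewrite dC; have := slack y; lia.
have := hmin h' h'D h'h x; rewrite /h'; case: asboolP => // _.
by have := slack x; lia.
Qed.
End Density.

(** * Finiteness of residues from the local rank bound *)

Section LocalRank.
Variables (X : Type) (d : X -> X -> nat).
Hypothesis hd : int_metric d.

(* The number of residues of [g] up to sign is bounded by the rank, and this bound is
   inherited by limits. *)
Lemma Ehull_finite_residues (f : X -> R) (eps : R) (n : nat) : Ehull d f -> 0 < eps ->
  (forall g, Eprime d g -> supdist_lt f g eps -> adim_le (Hspace d (Aset d g)) n) ->
  finite_residues f.
Proof.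
move=> fE eps0 hn; have [[z [zinj z0]]|[s hs]] :=
  many_or_few (fun x => `|res (f x)|) [:: 0; 2^-1] n.+1; last first.
  by exists ([:: 0; 2^-1] ++ s).
pose s := [:: 0; 2^-1] ++ [seq `|res (f (z i))| | i : 'I_n.+1].
have [e e0 he] := positive_gap [seq a - b | a <- s, b <- s].
have zs i : `|res (f (z i))| \in s.
  by rewrite mem_cat; apply/orP; right; apply/mapP; exists i; rewrite ?mem_enum.
have hgap a b : a \in s -> b \in s -> a != b -> e <= `|a - b|.
  have gt_gap u v : u \in s -> v \in s -> v < u -> e <= u - v.
    move=> us vs vu; have := he (u - v) 0 (allpairs_f _ us vs).
    by rewrite mulr0z add0r subr_gt0; apply.
  move=> sa sb; rewrite neq_lt => /orP[] ab; last first.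
    by apply: le_trans (gt_gap _ _ sa sb ab) (ler_norm _).
  by rewrite distrC; apply: le_trans (gt_gap _ _ sb sa ab) (ler_norm _).
(* Moving each residue by at most [e / 4] keeps the [n + 1] levels distinct and away from 0 and 1/2;
   [eps / 2] gives the strict inequality. *)
pose del := Num.min (e / 4) (eps / 2).
have del0 : 0 < del by rewrite lt_min; apply/andP; split; lra.
have [dele deleps] : del <= e / 4 /\ del <= eps / 2.
  by rewrite !ge_min !lexx orbT.
pose M := (Num.truncn del^-1).+1.
have Mdel : M%:R^-1 <= del.
  by rewrite -[leRHS]invrK lef_pV2 ?posrE ?invr_gt0 ?ltr0n // ltW // truncnS_gt.
have [g gE fg] := Eprime_dense hd fE (isT : (0 < M)%N).
have close x : `| `|res (g x)| - `|res (f x)| | <= e / 4.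
  rewrite ler_norml; have := norm_res_lip (g x) (f x); have := norm_res_lip (f x) (g x).
  by rewrite (distrC (g x) (f x)); have := le_trans (fg x) Mdel; lra.
case: (@residues_adim X d g n z).
- move=> i j gij; apply: zinj; apply/eqP; apply: contraT => /(hgap _ _ (zs i) (zs j)).
  move: (close (z i)) (close (z j)); rewrite gij !ler_norml => h1 h2 h3.
  have : `| `|res (f (z i))| - `|res (f (z j))| | <= e / 2 by rewrite ler_norml; lra.
  by lra.
- move=> i; apply/negP; rewrite !inE => gi.
  have := z0 i; rewrite !inE negb_or => /andP[n0 n1].
  have s0 : 0 \in s by rewrite inE eqxx.
  have s1 : 2^-1 \in s by rewrite !inE eqxx orbT.
  have := hgap _ _ (zs i) s0 n0; have := hgap _ _ (zs i) s1 n1.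
  move: (close (z i)); case/orP: gi => /eqP ->; rewrite distrC; lra.
- by apply: hn => //; exists M%:R^-1; split=> //; lra.
Qed.
End LocalRank.

(** * Finite convex hulls and their isometries *)

Section ConvexHull.
Variables (X : Type) (I : finType).
Implicit Types (p : I -> X -> R) (f g : X -> R) (a b c : I -> R) (C : (X -> R) -> Prop).

Definition weights c := (forall i, 0 <= c i) /\ \sum_i c i = 1.
Definition comb p c : X -> R := fun x => \sum_i c i * p i x.
Definition conv p g := exists2 c, weights c & g = comb p c.

Lemma conv_convex p : convex (conv p).
Proof.
move=> _ _ t [a [a0 a1] ->] [b [b0 b1] ->] t01.
exists (fun i => (1 - t) * a i + t * b i); first split=> [i|].
- by have := a0 i; have := b0 i; nra.
- by rewrite big_split -!mulr_sumr a1 b1 /=; ring.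
- apply/funext => x; rewrite /comb !mulr_sumr -big_split /=.
  by apply: eq_bigr => i _; ring.
Qed.

Lemma conv_point p i : conv p (p i).
Proof.
exists (fun j => (j == i)%:R); first split=> [j|]; first by rewrite ler0n.
  by rewrite (bigD1 i) //= eqxx big1 ?addr0 // => j /negbTE ->.
apply/funext => x; rewrite /comb (bigD1 i) //= eqxx mul1r big1 ?addr0 //.
by move=> j /negbTE ->; rewrite mul0r.
Qed.

Lemma conv_polytope p C : I -> (forall g, C g <-> conv p g) -> polytope C.
Proof.
move=> i0 Cp.
have eI : #|I| = #|I|.-1.+1 by rewrite prednK //; apply/card_gt0P; exists i0.
pose e (j : 'I_(#|I|.-1.+1)) : I := enum_val (cast_ord (esym eI) j).
have e_bij : bijective e.
  exists (fun i => cast_ord eI (enum_rank i)) => [j|i]; rewrite /e.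
    by rewrite enum_valK cast_ordKV.
  by rewrite cast_ordK enum_rankK.
have [e' eK e'K] := e_bij.
exists #|I|.-1, (fun j => p (e j)) => g; rewrite Cp; split.
  move=> [c [c0 c1] ->]; exists (fun j => c (e j)); split; first by move=> j.
  by split=> [|x]; [rewrite -c1|]; rewrite /comb (reindex e) //; apply: onW_bij.
move=> [c [c0 [c1 gc]]]; exists (fun i => c (e' i)); first split; first by move=> i.
  by rewrite -c1 (reindex e) /=; [under eq_bigr do rewrite eK|apply: onW_bij].
apply/funext => x; rewrite gc /comb [RHS](reindex e) /=; last exact: onW_bij.
by under [RHS]eq_bigr do rewrite eK.
Qed.

Lemma comb_sub p p' (x x' : X) a b (t : R) : weights a -> weights b ->
  (forall i, p i x = p' i x' + t) -> comb p a x - comb p b x = comb p' a x' - comb p' b x'.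
Proof.
move=> [_ a1] [_ b1] pp.
have E c : \sum_i c i = 1 -> comb p c x = comb p' c x' + t.
  move=> c1; rewrite /comb; under eq_bigr => i _ do rewrite pp mulrDr.
  by rewrite big_split /= -mulr_suml c1 mul1r.
by rewrite !E //; ring.
Qed.

(** Sup distances between combinations depend on the rows [i |-> p i x] only up to additive
    constants, so keeping the coefficients is an isometry. *)
Lemma conv_isometric p p' C C' :
  (forall g, C g <-> conv p g) -> (forall g, C' g <-> conv p' g) ->
  (forall x, exists x' t, forall i, p i x = p' i x' + t) ->
  (forall x', exists x t, forall i, p' i x' = p i x + t) -> isometric C C'.
Proof.
move=> Cp Cp' xx' x'x.
have /boolp.choice[w wP] : forall g, exists c, C g -> weights c /\ g = comb p c.
  move=> g; have [/Cp[c cw gc]|ng] := pselect (C g); first by exists c.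
  by exists (fun=> 0).
have dist a b e : weights a -> weights b ->
    supdist_le (comb p a) (comb p b) e <-> supdist_le (comb p' a) (comb p' b) e.
  move=> aw bw; split=> h x.
    by have [y [t e1]] := x'x x; rewrite (comb_sub aw bw e1).
  by have [y [t e1]] := xx' x; rewrite (comb_sub aw bw e1).
exists (fun g => comb p' (w g)); split; last split.
- by move=> g Cg; apply/Cp'; have [] := wP g Cg; exists (w g).
- move=> g /Cp'[c cw ->].
  have Cg : C (comb p c) by apply/Cp; exists c.
  exists (comb p c); split=> //; have [ww we] := wP _ Cg.
  (* The chosen weights may differ from [c], but they represent the same point for [p], so distance
     0 transfers to [p']. *)
  have : supdist_le (comb p (w (comb p c))) (comb p c) 0 by move=> x; rewrite -we subrr normr0.
  move/(dist _ _ _ ww cw) => h; apply/funext => x.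
  by apply/eqP; rewrite -subr_eq0 -normr_le0; apply: h.
- move=> g h e Cg Ch; have [gw ge] := wP _ Cg; have [hw he] := wP _ Ch.
  by rewrite {1}ge {1}he; apply: dist.
Qed.
End ConvexHull.

Lemma finite_isometry_types (X : Type) (T : finType) (Q : ((X -> R) -> Prop) -> Prop)
    (type : ((X -> R) -> Prop) -> T -> Prop) :
  (forall C, Q C -> exists t, type C t) ->
  (forall C C' t, type C t -> type C' t -> isometric C C') ->
  finitely_many_isometry_types Q.
Proof.
move=> Qt tiso.
have /boolp.choice[rep repP] : forall t, exists C, (exists C', type C' t) -> type C t.
  move=> t; have [[C Ct]|no] := pselect (exists C, type C t); first by exists C.
  by exists (fun=> False) => /no.
exists #|T|, (fun i => rep (enum_val i)) => C /Qt[t Ct].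
exists (enum_rank t); rewrite enum_rankK; apply: (tiso _ _ t) => //.
by apply: repP; exists C.
Qed.

(** * Cells as hulls of boundedly many half-integral points *)

Section CellHull.
Variables (X : Type) (d : X -> X -> nat).
Hypothesis hd : int_metric d.
Implicit Types (f g h : X -> R).

Lemma Pcell_convex f : Eprime d f -> convex (Pcell d (Aset d f)).
Proof.
move=> fE p q t [[pD _] pA] [[qD _] qA] t01; apply: Pcell_of => //.
  exact: Delta_mix.
by move=> x y xy; apply: Aset_mix; [apply: pA|apply: qA].
Qed.

Lemma Pcell_conv f (I : finType) (p : I -> X -> R) g : Eprime d f ->
  (forall i, Pcell d (Aset d f) (p i)) -> conv p g -> Pcell d (Aset d f) g.
Proof.
move=> fE pf [c [c0 c1] ->].
have E x y : comb p c x + comb p c y - (d x y)%:R =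
    \sum_i c i * (p i x + p i y - (d x y)%:R).
  rewrite -[in LHS](mul1r (d x y)%:R) -c1 mulr_suml /comb -big_split /= -sumrB.
  by apply: eq_bigr => i _; ring.
apply: Pcell_of => // x y; rewrite /Aset.
  rewrite -subr_ge0 E; apply: sumr_ge0 => i _; apply: mulr_ge0 => //.
  by rewrite subr_ge0; apply: (pf i).1.1.
move=> xy; apply/eqP; rewrite -subr_eq0 E big1 // => i _.
by rewrite (pf i).2 // subrr mulr0.
Qed.

(** Greedy choice: while two distinct points of the cell agree on the chosen [z i], their difference
    is a new direction vanishing there, and a point where they differ is added. Reaching [n + 1]
    directions would contradict the dimension. *)
Lemma Pcell_determining f n : Eprime d f -> finite_residues f ->
  adim_le (Pcell d (Aset d f)) n -> exists2 zs : seq X, (size zs <= n)%N &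
  forall p q, Pcell d (Aset d f) p -> Pcell d (Aset d f) q -> map p zs = map q zs -> p = q.
Proof.
move=> fE fr fn; set C := Pcell d (Aset d f).
have Cf : C f by split.
have [[v [z [va vz vtri]]]|//] :
  (exists (v : 'I_n.+1 -> X -> R) (z : 'I_n.+1 -> X),
   [/\ forall i, exists2 a, a != 0 & C (fun x => f x + a * v i x),
       forall i, v i (z i) != 0 & forall i j : 'I_n.+1, (i < j)%N -> v j (z i) = 0]) \/
  exists2 zs : seq X, (size zs < n.+1)%N &
    forall p q, C p -> C q -> map p zs = map q zs -> p = q; last first.
  by case: (triangular_adim Cf va vz vtri fn).
elim: n.+1 => [|k [[v [z [va vz vtri]]]|[zs zsk zsC]]]; last first.
- by right; exists zs => //; apply: leqW.
- pose zs := [seq z i | i : 'I_k].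
  have [zsC|] := pselect (forall p q, C p -> C q -> map p zs = map q zs -> p = q).
    by right; exists zs; rewrite // size_map size_enum_ord.
  move=> /existsNP[p /existsNP[q /not_implyP[Cp /not_implyP[Cq /not_implyP[pqz pq]]]]].
  have [x pqx] : exists x, p x != q x.
    by apply: contrapT => /forallNP h; apply: pq; apply/funext => x; have /negP/negPn/eqP := h x.
  left; exists (fun i => if unlift ord_max i is Some j then v j else fun x => p x - q x).
  exists (fun i => if unlift ord_max i is Some j then z j else x).
  have pqz0 i : p (z i) = q (z i).
    by move: pqz; rewrite -!map_comp => /eq_in_map h; apply: (h i); rewrite -enumT mem_enum.
  split=> [i|i|i j].
  + case: unliftP => [j _|_]; first exact: va.
    have vb y : `|p y - q y| <= p x + q x.
      exact: (Eprime_dist hd y x Cp.1 Cq.1).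
    have vA y y' : Aset d f y y' -> (p y - q y) + (p y' - q y') = 0.
      by move=> yy'; have := Cp.2 _ _ yy'; have := Cq.2 _ _ yy'; lra.
    have [a a0 Ca] := interior fE fr vb vA.
    by exists a; rewrite ?lt0r_neq0.
  + by case: unliftP => [j _|_]; rewrite ?subr_eq0.
  + case: unliftP => [j' ->|->]; case: unliftP => [i' ->|->]; rewrite ?lift_max.
    * exact: vtri.
    * by rewrite ltnNge ltnW.
    * by rewrite pqz0 subrr.
    * by rewrite ltnn.
- by left; have z : 'I_0 -> X by [case]; exists (fun=> f), z; split; case.
Qed.

Lemma half_integral_code g h x (B : nat) : half_integral g -> half_integral h ->
  `|g x - h x| * 2 <= B%:R -> exists k : 'I_(2 * B).+1, g x = h x - B%:R / 2 + (k : nat)%:R / 2.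
Proof.
move=> /(_ x)[i gi] /(_ x)[j hj]; rewrite gi hj -mulrBl -rmorphB /= => ijB.
have : `|(i - j)%:~R| <= B%:R :> R.
  move: ijB; rewrite normrM (ger0_norm (_ : 0 <= 2^-1 :> R)) ?invr_ge0 //.
  by rewrite divfK ?pnatr_eq0.
rewrite -intr_norm pmulrn ler_int => ij.
have k1 : (`|(i - j + B%:Z)%R|%N < (2 * B).+1)%N by lia.
exists (Ordinal k1) => /=.
have -> : (`|(i - j + B%:Z)%R|%N)%:R = (i - j + B%:Z)%:~R :> R.
  by rewrite pmulrn; congr (_ %:~R); lia.
by rewrite rmorphD rmorphB /= -pmulrn; field.
Qed.

(** Half-integral points are coded by their offsets from one of them at the determining points. The
    index type depends only on [n] and [B], which makes different cells comparable. *)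
Lemma Pcell_half_integral f n (B : nat) (D : R) : Eprime d f ->
  (forall g, Eprime d g -> finite_residues g) ->
  adim_le (Pcell d (Aset d f)) n -> diam_le (Pcell d (Aset d f)) D -> D * 2 <= B%:R ->
  exists p : {bseq n of 'I_(2 * B).+1} -> X -> R,
  [/\ forall g, Pcell d (Aset d f) g <-> conv p g,
      forall h, half_integral h -> Pcell d (Aset d f) h -> exists i, h = p i &
      exists b : X -> R, forall x i, exists k : 'I_(2 * B).+1, p i x = b x + (k : nat)%:R / 2].
Proof.
move=> fE fr fn fD DB; set C := Pcell d (Aset d f).
have [zs zsn zsC] := Pcell_determining fE (fr _ fE) fn.
have [h0 [h0half Ch0]] : exists h, half_integral h /\ C h.
  (* A constant predicate is convex, so the hull principle also proves existence. *)
  apply: (@hull _ d f (fun=> exists h, half_integral h /\ C h)) => //.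
    exact: fr.
  by move=> h hh Ch; exists h.
have code h : half_integral h -> C h -> forall x, exists k : 'I_(2 * B).+1,
    h x = h0 x - B%:R / 2 + (k : nat)%:R / 2.
  move=> hh Ch x; apply: half_integral_code => //; apply: le_trans DB.
  by rewrite ler_pM2r //; apply: fD.
pose fits (h : X -> R) (i : {bseq n of 'I_(2 * B).+1}) :=
  exists2 k : X -> 'I_(2 * B).+1, i = map k zs :> seq _ &
    forall x, h x = h0 x - B%:R / 2 + (k x : nat)%:R / 2.
have /boolp.choice[p pP] : forall i, exists h, [/\ half_integral h, C h &
    (exists2 h', half_integral h' /\ C h' & fits h' i) -> fits h i].
  move=> i; have [[h [hh Ch] hi]|no] :=
    pselect (exists2 h', half_integral h' /\ C h' & fits h' i); first by exists h.
  by exists h0; split=> // /no.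
have ph h : half_integral h -> C h -> exists i, h = p i.
  move=> hh Ch; have /boolp.choice[k kP] := code h hh Ch.
  have ks : (size (map k zs) <= n)%N by rewrite size_map.
  have [hp Chp [k' k'i k'P]] : [/\ half_integral (p (Bseq ks)), C (p (Bseq ks)) &
      fits (p (Bseq ks)) (Bseq ks)].
    by have [? ? hi] := pP (Bseq ks); split=> //; apply: hi; exists h => //; exists k.
  exists (Bseq ks).
  have agree x : k x = k' x -> h x = p (Bseq ks) x by move=> kx; rewrite kP k'P kx.
  apply: zsC => //; move: (p _) agree (k'i : map k zs = map k' zs) => q agree.
  by elim: (zs) => //= x ys IH [/agree -> /IH ->].
exists p; split=> [g||]; last 2 first.
- exact: ph.
- exists (fun x => h0 x - B%:R / 2) => x i.
  by have [? ? _] := pP i; apply: code.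
split=> [Cg|]; last by apply: Pcell_conv => // i; case: (pP i).
have gE : Eprime d g by case: Cg.
apply: (@hull _ d g (conv p)) => //; [exact: fr|exact: conv_convex|].
move=> h hh [hE hA].
have [|i ->] := ph h hh; last exact: conv_point.
by split=> // x y /(Cg.2) /hA.
Qed.
End CellHull.

(** * Faces of cells and counting of isometry types *)

Section PolyhedralStructure.
Variables (X : Type) (d : X -> X -> nat).
Hypotheses (hd : int_metric d) (fr : forall g, Eprime d g -> finite_residues g).
Implicit Types (f g h : X -> R).

Lemma PfamilyP (C : (X -> R) -> Prop) :
  Pfamily d C <-> exists2 f, Eprime d f & C = Pcell d (Aset d f).
Proof.
split=> [[A [[f [fE Af]] CA]]|[f fE ->]]; last first.
  by exists (Aset d f); split=> //; exists f.
exists f => //; apply/funext => g; apply/propext; rewrite CA.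
by split=> -[gE gA]; split=> // x y /Af; apply: gA.
Qed.

Lemma Pcell_self f : Eprime d f -> Pcell d (Aset d f) f.
Proof. by split. Qed.

Lemma Pcell_sub f f' : Pcell d (Aset d f) f' ->
  forall g, Pcell d (Aset d f') g -> Pcell d (Aset d f) g.
Proof. by move=> ff' g [gE gf']; split=> // x y /(ff'.2) /gf'. Qed.

Lemma Eprime_bounded f g : Eprime d f -> Eprime d g ->
  exists2 b : R, 0 <= b & forall x, `|f x - g x| <= b.
Proof.
move=> fE gE; have [[z]|noX] := pselect (inhabited X); last first.
  by exists 0 => // x; case: noX.
exists (f z + g z) => [|x]; last exact: (Eprime_dist hd x z fE gE).
by rewrite addr_ge0 ?(Delta_ge0 _ fE.1) ?(Delta_ge0 _ gE.1).
Qed.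

Lemma Pcell_bounded f : Eprime d f -> exists D : R, diam_le (Pcell d (Aset d f)) D.
Proof.
move=> fE; have [[z]|noX] := pselect (inhabited X); last first.
  by exists 0 => g h _ _ x; case: noX.
have [y fzy] := fE.2 z; exists (2 * (d z y)%:R) => g h [gE /(_ _ _ fzy) ge] [hE /(_ _ _ fzy) he] x.
apply: le_trans (Eprime_dist hd x z gE hE) _.
by have := Delta_ge0 y gE.1; have := Delta_ge0 y hE.1; lra.
Qed.

Lemma Pcell_polytope f n : Eprime d f -> adim_le (Pcell d (Aset d f)) n ->
  polytope (Pcell d (Aset d f)).
Proof.
move=> fE fn; have [D fD] := Pcell_bounded fE.
have [p [pC _ _]] := Pcell_half_integral hd fE fr fn fD (ltW (truncnS_gt _)).
exact: (conv_polytope [bseq] pC).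
Qed.

(** A pair tight at an inner point of a segment in Delta(X) is tight at both ends, so imposing
    further tight pairs cuts out an extreme subset. *)
Lemma Pcell_setI_face f f' g : Eprime d f -> Eprime d f' ->
  Pcell d (Aset d f) g -> Pcell d (Aset d f') g ->
  face (fun h => Pcell d (Aset d f) h /\ Pcell d (Aset d f') h) (Pcell d (Aset d f)).
Proof.
move=> fE f'E fg f'g; split; first by exists g.
split; first by move=> h [].
split; first by move=> p q t [? ?] [? ?] t01; split; apply: Pcell_convex.
move=> p q t fp fq t01 [_ [_ mA]].
have tight x y : Aset d f' x y -> Aset d p x y /\ Aset d q x y.
  by move=> /mA; apply: Aset_mix_inv => //; [case: fp.1|case: fq.1].
by split; split=> //; (split; first by [case: fp|case: fq]) => x y /tight[].
Qed.

Lemma Pcell_face_iff f f' : Eprime d f -> Eprime d f' ->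
  (face (Pcell d (Aset d f')) (Pcell d (Aset d f)) <->
   forall x y, Aset d f x y -> Aset d f' x y).
Proof.
move=> fE f'E; split=> [[_ [sub _]] x y|ff'].
  exact: (sub f' (Pcell_self f'E)).2.
have ff'P : Pcell d (Aset d f) f' by split.
have -> : Pcell d (Aset d f') = fun h => Pcell d (Aset d f) h /\ Pcell d (Aset d f') h.
  by apply/funext => h; apply/propext; split=> [hf'|[]//]; split=> //; apply: Pcell_sub hf'.
exact: Pcell_setI_face ff'P (Pcell_self f'E).
Qed.

(* A point of the face lying with as many half-integral points as possible in its own
   cell is relatively interior to the face. *)
Lemma Pcell_face f n (F : (X -> R) -> Prop) : Eprime d f ->
  adim_le (Pcell d (Aset d f)) n -> face F (Pcell d (Aset d f)) ->
  exists2 f', Eprime d f' & F = Pcell d (Aset d f').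
Proof.
move=> fE fn [[f0 Ff0] [Fsub [Fconv Fext]]]; have [D fD] := Pcell_bounded fE.
have [p [_ pP _]] := Pcell_half_integral hd fE fr fn fD (ltW (truncnS_gt _)).
pose out g := [set i | ~~ `[< Pcell d (Aset d g) (p i) >]]%SET.
have [f' Ff' f'min] := ex_argmin_nat (fun g => #|out g|) Ff0.
have [f'E f'A] := Fsub _ Ff'.
exists f' => //; apply/funext => g; apply/propext; split=> [Fg|gf'].
  have [gE gA] := Fsub _ Fg.
  (* Pairs tight at the midpoint are tight at [f'] and at [g]; minimality then puts all
     half-integral points of P(A(g)) into P(A(f')). *)
  pose m x := (1 - 2^-1) * f' x + 2^-1 * g x.
  have Fm : F m by apply: Fconv => //; lra.
  have mA x y : Aset d m x y -> Aset d f' x y /\ Aset d g x y.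
    by apply: Aset_mix_inv; [case: f'E|case: gE|lra].
  have out_m g' : (forall x y, Aset d m x y -> Aset d g' x y) -> out m \subset out g'.
    move=> mg'; apply/fintype.subsetP => i; rewrite !inE; apply: contraNN => /asboolP[pE pA].
    by apply/asboolP; split=> // x y /mg' /pA.
  have mf' : out m = out f'.
    by apply/eqP; rewrite eqEcard f'min // out_m // => x y /mA[].
  have Em : out f' \subset out g by rewrite -mf'; apply: out_m => x y /mA[].
  apply: (hull gE (fr gE) (Pcell_convex f'E)) => h hh [hE hA].
  have [|i hi] := pP h hh; first by split=> // x y /gA /hA.
  apply/asboolP/negPn; rewrite hi; apply/negP => hout.
  have : i \in out g by apply: (fintype.subsetP Em); rewrite inE.
  by rewrite inE -hi => /negP; apply; apply/asboolP.
have [gE gA] := gf'.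
have [b b0 gb] := Eprime_bounded f'E gE.
have vA x y : Aset d f' x y -> (f' x - g x) + (f' y - g y) = 0.
  by move=> xy; have := gA _ _ xy; move: xy; rewrite /Aset; lra.
have [a a0 ha] := interior f'E (fr f'E) gb vA.
have a1 : 0 < 1 + a by lra.
(* Prolong the segment from [g] beyond [f']: now [f'] is an inner point with parameter [1/(1 + a)],
   and extremality of [F] gives [g]. *)
have [||||//] := Fext g (fun x => f' x + a * (f' x - g x)) (1 + a)^-1.
- exact: (Pcell_sub (Fsub _ Ff')).
- exact: (Pcell_sub (Fsub _ Ff')).
- by rewrite invr_gt0 a1 invf_lt1 //; lra.
- congr F: Ff'; apply/funext => x; field; lra.
Qed.

(** Move from [g] slightly towards [f]. As A(h) is contained in A(f), the cell of [f] lies in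
    H(A(h)), so a rank bound near [g] bounds the dimension of the whole cell. *)
Lemma Pcell_near f g (eps : R) : Eprime d f -> Pcell d (Aset d f) g -> 0 < eps ->
  exists2 h, Eprime d h & (forall x y, Aset d h x y -> Aset d f x y) /\ supdist_le g h eps.
Proof.
move=> fE gf eps0; have [gE gA] := gf; have [b b0 fgb] := Eprime_bounded fE gE.
have p0 : 0 < eps + b + 1 by lra.
pose t := eps / (eps + b + 1).
have t0 : 0 < t by rewrite divr_gt0.
have t1 : t < 1 by rewrite /t ltr_pdivrMr //; lra.
have tb : t * b <= eps by rewrite /t mulrAC ler_pdivrMr // ler_pM2l //; lra.
exists (fun x => (1 - t) * g x + t * f x).
  suff [] : Pcell d (Aset d f) (fun x => (1 - t) * g x + t * f x) by [].
  by apply: Pcell_convex => //; rewrite ?ltW //; apply: Pcell_self.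
split=> [x y|x].
  have t01 : 0 < t < 1 by rewrite t0.
  by move=> xy; have [] := Aset_mix_inv gE.1 fE.1 t01 xy.
have -> : g x - ((1 - t) * g x + t * f x) = t * - (f x - g x) by ring.
by rewrite normrM normrN (gtr0_norm t0); apply: le_trans tb; rewrite ler_pM2l.
Qed.

Lemma isometry_types n (D : R) : finitely_many_isometry_types
  (fun C => [/\ Pfamily d C, adim_eq C n & diam_le C D]).
Proof.
pose B := (Num.truncn (D * 2)).+1.
pose I := {bseq n of 'I_(2 * B).+1}.
(* A row records the values of all generators at one [x], in units of 1/2 above [b x]; the set of
   occurring rows is the type of the cell. *)
pose row (p : I -> X -> R) (b : X -> R) x (r : {ffun I -> 'I_(2 * B).+1}) :=
  forall i, p i x = b x + (r i : nat)%:R / 2.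
apply: (@finite_isometry_types X {set {ffun I -> 'I_(2 * B).+1}} _
  (fun C t => exists p b, [/\ forall g, C g <-> conv p g,
     forall x, exists2 r, r \in t & row p b x r &
     forall r, r \in t -> exists x, row p b x r])).
  move=> C [/PfamilyP[f fE ->] [_ fn] fD].
  have [p [pC _ [b bP]]] := Pcell_half_integral hd fE fr fn fD (ltW (truncnS_gt _)).
  exists [set r | `[< exists x, row p b x r >]]%SET, p, b; split=> // [x|r].
    have /boolp.choice[r rP] := bP x; exists [ffun i => r i]; last by move=> i; rewrite ffunE.
    by rewrite inE; apply/asboolP; exists x => i; rewrite ffunE.
  by rewrite inE => /asboolP.
move=> C C' t [p [b [pC pt tp]]] [p' [b' [pC' pt' tp']]].
apply: (conv_isometric pC pC') => x.
  have [r rt xr] := pt x; have [x' x'r] := tp' r rt.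
  by exists x', (b x - b' x') => i; rewrite xr x'r; ring.
have [r rt xr] := pt' x; have [x' x'r] := tp r rt.
by exists x', (b' x - b x') => i; rewrite xr x'r; ring.
Qed.

(** Discrete intermediate values: steps of at most 2 cannot jump over the window [s, s + 2). *)
Lemma crossing (u : nat -> R) (s : R) l : u 0%N < s -> s <= u l ->
  (forall k, (k < l)%N -> u k.+1 <= u k + 2) -> exists k, s <= u k < s + 2.
Proof.
elim: l => [|l IH] u0 ul ustep; first by lra.
have [sl|ls] := lerP s (u l); first by apply: IH => // k kl; apply: ustep; apply: ltnW.
by exists l.+1; have := ustep l (leqnn _); lra.
Qed.

(* Along a path from [x] to [y] with {x, y} in A(f), the function [g - h] changes sign in
   steps of size at most 2, so its absolute value has many levels if it is large at [x]. *)
Lemma Pcell_diam f n : discretely_path_connected d -> Eprime d f ->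
  adim_le (Pcell d (Aset d f)) n -> diam_le (Pcell d (Aset d f)) (2 * n.+1%:R).
Proof.
move=> conn fE fn g h [gE gA] [hE hA] x; rewrite leNgt; apply/negP => big.
pose v x := g x - h x.
have vA y z : Aset d f y z -> v y + v z = 0.
  by move=> yz; have := gA _ _ yz; have := hA _ _ yz; rewrite /v; lra.
have [y xy] := fE.2 x.
have [a [b [va vb]]] : exists a b, v a < 0 /\ 2 * n.+1%:R <= v b.
  have vxy := vA _ _ xy; have n0 := ltr0Sn R n.
  have [vx|vx] := lerP 0 (v x).
    by rewrite -/(v x) ger0_norm // in big; exists y, x; split; lra.
  by rewrite -/(v x) ltr0_norm // in big; exists x, y; split; lra.
have [l [gam [gam0 [gaml step]]]] := conn a b.
have [_ [dC _]] := hd.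
have vstep k : (k < l)%N -> v (gam k.+1) <= v (gam k) + 2.
  move=> kl; have := step k.+1 kl => /= dk.
  have := Eprime_lip hd (gam k.+1) (gam k) gE; have := Eprime_lip hd (gam k) (gam k.+1) hE.
  by rewrite (dC (gam k.+1)) dk /v; lra.
(* The [n + 1] windows [2j + 2, 2j + 4) are disjoint and start above [v a] and at most at [v b], so
   the path meets each of them. *)
have /boolp.choice[k kP] : forall j : 'I_n.+1, exists k,
    2 * j.+1%:R <= v (gam k) < 2 * j.+1%:R + 2.
  move=> j; apply: (crossing (l := l) (u := fun k => v (gam k))) => //.
    by rewrite gam0; have := ltr0Sn R j; lra.
  by rewrite gaml; apply: le_trans vb; rewrite ler_pM2l // ler_nat.
have k0 j : 0 < v (gam (k j)) by have := kP j; have := ltr0Sn R j; lra.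
apply: (@levels_adim _ _ f (Aset d f) n v (fun j => gam (k j)) (Pcell_self fE) _ vA) fn.
- move=> w w1 wA; have [c c0 fc] := interior fE (fr fE) w1 wA.
  by exists c; rewrite ?lt0r_neq0.
- have key (i j : 'I_n.+1) : (i < j)%N -> v (gam (k i)) < v (gam (k j)).
    move=> ij; have := kP i; have := kP j.
    have : i.+1%:R + 1 <= j.+1%:R :> R by rewrite natr1 ler_nat.
    by lra.
  move=> i j; rewrite !gtr0_norm // => vij; apply: val_inj.
  by have [/key|/key|//] := ltngtP i j; rewrite vij ltxx.
- by move=> j; rewrite lt0r_neq0.
Qed.
End PolyhedralStructure.

(** * Assembling the three assertions *)

Theorem theorem4p5 (X : Type) (d : X -> X -> nat) (hd : int_metric d)
  (hyp : forall f : X -> R, Ehull d f ->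
     exists eps : R, 0 < eps /\ exists N : nat, (0 < N)%N /\
       forall g : X -> R, Eprime d g -> supdist_lt f g eps ->
         adim_le (Hspace d (Aset d g)) N) :
  (* (1) E'(X) = E(X) *)
  (forall f : X -> R, Eprime d f <-> Ehull d f) /\
  (* (2) polyhedral structure with locally finite dimension; faces vs inclusion *)
  (polyhedral_structure (Pfamily d) (Ehull d) /\
   locally_finite_dim (Pfamily d) (Ehull d) /\
   (forall A A' : X -> X -> Prop, in_scrA d A -> in_scrA d A' ->
      (face (Pcell d A') (Pcell d A) <-> (forall x y, A x y -> A' x y)))) /\
  (* (3) finiteness of isometry types of cells *)
  ((forall (n : nat) (D : R), (1 <= n)%N -> 0 < D ->
      finitely_many_isometry_types
        (fun C => Pfamily d C /\ adim_eq C n /\ diam_le C D)) /\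
   (discretely_path_connected d ->
      forall n : nat,
        finitely_many_isometry_types (fun C => Pfamily d C /\ adim_eq C n))).
Proof.
have Efr f : Ehull d f -> finite_residues f.
  move=> fE; have [eps [eps0 [N [_ fN]]]] := hyp f fE.
  exact: (Ehull_finite_residues hd fE eps0 fN).
have fr f : Eprime d f -> finite_residues f by move=> /Eprime_Ehull /Efr.
have EE f : Eprime d f <-> Ehull d f.
  by split=> [|fE]; [exact: Eprime_Ehull|exact: (finite_residues_Eprime hd fE (Efr f fE))].
have sub_dim (S S' : (X -> R) -> Prop) n : (forall g, S g -> S' g) -> adim_le S' n -> adim_le S n.
  by move=> SS' S'n p Sp; apply: S'n => i; apply: SS'.
have dim f : Eprime d f -> exists n, adim_le (Pcell d (Aset d f)) n.
  move=> fE; have [eps [eps0 [N [_ fN]]]] := hyp f (Eprime_Ehull fE); exists N.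
  apply: sub_dim (fN f fE _); first by move=> g [].
  by exists 0; split=> // x; rewrite subrr normr0.
split=> //; split; first split; [|split|].
- split; first by move=> C /PfamilyP[f fE ->]; have [n fn] := dim f fE; apply: Pcell_polytope fn.
  split=> [f|].
    split=> [/EE fE|[C [CP Cf]]]; last first.
      by apply/EE; case/PfamilyP: CP Cf => g gE -> [].
    by exists (Pcell d (Aset d f)); split; [apply/PfamilyP; exists f|split].
  split=> [C F /PfamilyP[f fE ->] Ff|C C' /PfamilyP[f fE ->] /PfamilyP[g gE ->]].
    have [n fn] := dim f fE; have [f' f'E ->] := Pcell_face hd fr fE fn Ff.
    by apply/PfamilyP; exists f'.
  have [[h [hf hg]]|no] := pselect (exists h, Pcell d (Aset d f) h /\ Pcell d (Aset d g) h).
    right; split; first exact: Pcell_setI_face hf hg.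
    have -> : (fun h => Pcell d (Aset d f) h /\ Pcell d (Aset d g) h) =
              (fun h => Pcell d (Aset d g) h /\ Pcell d (Aset d f) h).
      by apply/funext => k; apply/propext; split=> -[].
    exact: Pcell_setI_face hg hf.
  by left=> h hfg; apply: no; exists h.
- move=> f /[dup] fE /hyp[eps [eps0 [N [_ fN]]]]; exists eps; split=> //; exists N.
  move=> C /PfamilyP[g gE ->] [h [hg [c [ceps fh]]]].
  (* Half of the margin [eps - c] keeps the perturbed point within [eps] of [f]. *)
  have e0 : 0 < (eps - c) / 2 by lra.
  have [k kE [kg hk]] := Pcell_near hd gE hg e0.
  apply: sub_dim (fN k kE _); first by move=> l [_ gl] x y /kg /gl.
  exists (c + (eps - c) / 2); split=> [|x]; first by lra.
  have -> : f x - k x = (f x - h x) + (h x - k x) by ring.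
  by apply: le_trans (ler_normD _ _) (lerD (fh x) (hk x)).
- move=> A A' [f [fE Af]] [f' [f'E Af']].
  have -> : A = Aset d f by apply/funext => x; apply/funext => y; apply/propext.
  have -> : A' = Aset d f' by apply/funext => x; apply/funext => y; apply/propext.
  exact: Pcell_face_iff.
have mono (Q Q' : ((X -> R) -> Prop) -> Prop) : (forall C, Q C -> Q' C) ->
    finitely_many_isometry_types Q' -> finitely_many_isometry_types Q.
  by move=> QQ' [m [reps h]]; exists m, reps => C /QQ' /h.
split=> [n D _ _|conn n].
  by apply: mono (isometry_types hd fr n D) => C [? []].
apply: mono (isometry_types hd fr n (2 * n.+1%:R)) => C [CP Cn]; split=> //.
by case/PfamilyP: CP Cn => f fE -> [_ fn]; apply: Pcell_diam.
Qed.
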